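(* Fix a configuration of four pairwise intersecting line segments in $\mathbb{R}^2$ in which no three intersect at the same point. Such segments necessarily bound a quadrilateral $Q$ and two triangles $T_1$ and $T_2$. Label the sides of $Q$ as $A_1,A_2,A_3,A_4$ and the remaining sides of the two triangles as $B_1,B_2,B_3,B_4$ following the labeling convention given in the context, let $a_i>0$ be the length of $A_i$, and write the length of $B_i$ as $b_i a_i$ with $b_i>0$, for $i=1,\dots,4$. Then the ratios $b_1,\ldots,b_4$ satisfy $$b_2 b_3 = b_1(b_2+1) \qquad\text{and}\qquad b_1 b_4 = (b_1+1) b_2.$$ In particular, specifying rational values for any two of the $b_i$'s uniquely determines rational values for the other two.
   Context: Labeling convention. The four segments lie on four lines $\ell_1,\ell_2,\ell_3,\ell_4$, and have six pairwise intersection points. The lines are labeled so that the bounded quadrilateral $Q$ has sides $A_1,A_2,A_3,A_4$ in cyclic order with $A_i \subset \ell_i$; write $P_{12}=A_1\cap A_2$, $P_{23}=A_2\cap A_3$, $P_{34}=A_3\cap A_4$, $P_{41}=A_4\cap A_1$ for its vertices. The remaining two intersection points are $X=\ell_1\cap\ell_3$ and $Y=\ell_2\cap\ell_4$. The labels are chosen so that $X$ lies on $\ell_1$ beyond $P_{41}$ (i.e. $P_{41}$ lies strictly between $P_{12}$ and $X$) and on $\ell_3$ beyond $P_{34}$ (i.e. $P_{34}$ lies strictly between $P_{23}$ and $X$), while $Y$ lies on $\ell_2$ beyond $P_{23}$ (i.e. $P_{23}$ lies strictly between $P_{12}$ and $Y$) and on $\ell_4$ beyond $P_{34}$ (i.e.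 $P_{34}$ lies strictly between $P_{41}$ and $Y$). The two bounded triangles are the triangle with vertices $P_{41},P_{34},X$, whose sides are $A_4$, $B_1=P_{41}X$ and $B_3=P_{34}X$, and the triangle with vertices $P_{34},P_{23},Y$, whose sides are $A_3$, $B_2=P_{23}Y$ and $B_4=P_{34}Y$. Thus each $B_i$ lies on the same line $\ell_i$ as $A_i$ and extends it. *)

(* Defs.v *)
From HB Require Import structures.
From mathcomp Require Import all_boot all_order all_algebra perm.
From mathcomp Require Import all_classical all_reals all_analysis.

Set Implicit Arguments.
Unset Strict Implicit.
Unset Printing Implicit Defensive.

Import Order.TTheory GRing.Theory Num.Theory.
Import numFieldNormedType.Exports.

Local Open Scope classical_set_scope.
Local Open Scope ring_scope.

(* Indices 1, ..., 4, with underlying values 0, ..., 3. *)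
Notation i1 := (@Ordinal 4 0 isT).
Notation i2 := (@Ordinal 4 1 isT).
Notation i3 := (@Ordinal 4 2 isT).
Notation i4 := (@Ordinal 4 3 isT).

Section Defs.
Variable R : realType.

Local Notation point := 'rV[R]_2.

(* The norm that the library puts on 'rV[R]_2 is the sup norm, hence this
   explicit Euclidean distance. *)
Definition dist (p q : point) : R :=
  Num.sqrt (\sum_(k < 2) (p 0 k - q 0 k) ^+ 2).

(* A segment is given by the pair of its endpoints. *)
Definition seg (s : point * point) : set point :=
  [set (1 - t) *: s.1 + t *: s.2 | t in `[0, 1]].

Definition len (s : point * point) : R := dist s.1 s.2.

(* q lies strictly between p and r *)
Definition between (p q r : point) : Prop :=
  p != r /\ exists2 t : R, 0 < t < 1 & q = (1 - t) *: p + t *: r.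

(* Endpoints are not assumed distinct and segments are not assumed to lie on
   distinct lines: a one-point segment, or two segments on a common line, would
   force three of the segments to share a point. *)
Definition configuration (S : 'I_4 -> point * point) : Prop :=
  (forall i j, seg (S i) `&` seg (S j) !=set0) /\
  (forall i j k, i != j -> j != k -> i != k ->
     seg (S i) `&` seg (S j) `&` seg (S k) = set0).

Record vertices := Vertices {
  P12 : point; P23 : point; P34 : point; P41 : point; X : point; Y : point }.

(* T lists the segments in labelled order; T i lies on the i-th line. *)
Record labeling (T : 'I_4 -> point * point) (v : vertices) : Prop := Labeling {
  meet12 : seg (T i1) `&` seg (T i2) = [set P12 v];
  meet23 : seg (T i2) `&` seg (T i3) = [set P23 v];
  meet34 : seg (T i3) `&` seg (T i4) = [set P34 v];
  meet41 : seg (T i4) `&` seg (T i1) = [set P41 v];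
  meet13 : seg (T i1) `&` seg (T i3) = [set X v];
  meet24 : seg (T i2) `&` seg (T i4) = [set Y v];
  X_on_1 : between (P12 v) (P41 v) (X v);
  X_on_3 : between (P23 v) (P34 v) (X v);
  Y_on_2 : between (P12 v) (P23 v) (Y v);
  Y_on_4 : between (P41 v) (P34 v) (Y v) }.

Definition sideA (v : vertices) (i : 'I_4) : point * point :=
  tnth [tuple (P41 v, P12 v); (P12 v, P23 v); (P23 v, P34 v); (P34 v, P41 v)] i.

Definition sideB (v : vertices) (i : 'I_4) : point * point :=
  tnth [tuple (P41 v, X v); (P23 v, Y v); (P34 v, X v); (P34 v, Y v)] i.

Definition a (v : vertices) (i : 'I_4) : R := len (sideA v i).
Definition b (v : vertices) (i : 'I_4) : R := len (sideB v i) / a v i.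

Definition frontier (F : set point) : set point := closure F `\` interior F.

(* The bounded regions that the segments cut out of the plane. *)
Definition bounded_faces (S : 'I_4 -> point * point) : set (set point) :=
  let U := \bigcup_i seg (S i) in
  [set F | bounded_set F /\ exists2 x, ~ U x & F = connected_component (~` U) x].

(* The bounded regions are exactly the quadrilateral with sides A_1, ..., A_4
   and the two triangles with sides A_4, B_1, B_3 and A_3, B_2, B_4. *)
Definition bound_quad_and_triangles
    (S : 'I_4 -> point * point) (v : vertices) : Prop :=
  exists Q T1 T2 : set point,
    [/\ bounded_faces S = [set Q; T1; T2],
        frontier Q = \bigcup_i seg (sideA v i),
        frontier T1 =
          seg (sideA v i4) `|` seg (sideB v i1) `|` seg (sideB v i3) &
        frontier T2 =
          seg (sideA v i3) `|` seg (sideB v i2) `|` seg (sideB v i4)].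

End Defs.

(* Main.v *)
(** Take P12 as origin and X, Y as unit points of two affine axes.  With
    P41 = (p, 0) and P23 = (0, q) the four lines are y = 0, x = 0, q x + y = q
    and x + p y = p, so that every ratio is b_i = (1 - t_i) / t_i with t_i one of
    p, q and the two coordinates of P34; the relations are then identities in p
    and q.

    The cells of the line arrangement with x > 0 and y > 0, except the one beyond
    both other lines, are the bounded faces: each is open, convex and has its
    boundary covered by the segments.  From any other point of the complement
    some ray to infinity avoids the segments: in a recession direction of its
    cell if the point is on no line, and along the line, away from the segment,
    otherwise.

    For the existence of a labelling, mark on each line the middle one of its
    three intersection points.  A line through no vertex of a triangle crosses
    its boundary an even number of times (Pasch), so each line carries zero or two
    marks set on the other lines.  Only one pattern, up to renaming, is left.  *)

Require Import Defs.
From HB Require Import structures.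
From mathcomp Require Import all_boot all_order all_algebra perm.
From mathcomp Require Import all_classical all_reals all_analysis.
From mathcomp Require Import ring lra.

Set Implicit Arguments.
Unset Strict Implicit.
Unset Printing Implicit Defensive.

Import Order.TTheory GRing.Theory Num.Theory.
Import numFieldNormedType.Exports.

Local Open Scope classical_set_scope.
Local Open Scope ring_scope.

(** * Connected components and convex polyhedra *)

Section Topology.
Variables (R : realType) (V : normedModType R).
Implicit Types (A P U : set V) (z c d : V).

Lemma line_continuous z d : continuous (fun t : R => z + t *: d).
Proof.
move=> t; apply: cvgD; first exact: cvg_cst.
by apply: cvgZr_tmp; exact: cvg_id.
Qed.

(** [A] is the union of the segments joining [c] to its points; these are connected and share
    [c]. *)
Lemma star_connected A c :
  A c -> (forall z t, A z -> 0 <= t <= 1 -> A (c + t *: (z - c))) ->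
  connected A.
Proof.
move=> Ac starA.
have -> : A = \bigcup_(z in A) [set c + t *: (z - c) | t in `[0, 1]].
  apply/seteqP; split=> [z Az|_ [z Az] [t t01 <-]].
    by exists z => //; exists 1; rewrite /= ?in_itv/= ?lexx ?ler01// scale1r subrKC.
  by apply: starA; rewrite // in_itv in t01.
apply: bigcup_connected.
  by exists c => z _; exists 0; rewrite /= ?in_itv/= ?lexx ?ler01// scale0r addr0.
move=> z _; apply: connected_continuous_connected.
  exact: segment_connected.
by apply: continuous_subspaceT; exact: line_continuous.
Qed.

Lemma ray_unbounded A z d : d != 0 -> (forall t, 0 <= t -> A (z + t *: d)) ->
  ~ bounded_set (connected_component A z).
Proof.
move=> d0 Ad [M [_ bd]].
pose r := [set z + t *: d | t in [set t : R | 0 <= t]].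
have rC : r `<=` connected_component A z.
  apply: connected_component_max.
  - by exists 0; rewrite /= ?lexx// scale0r addr0.
  - by move=> _ [t t0 <-]; exact: Ad.
  - apply: (@star_connected _ z); first by exists 0; rewrite /= ?lexx// scale0r addr0.
    move=> _ t [u /= u0 <-] /andP[t0 _]; exists (t * u); first exact: mulr_ge0.
    by rewrite [z + _ - z]addrC addKr scalerA.
have nd : 0 < `|d| by rewrite normr_gt0.
pose M1 := `|M| + 1.
have M1M : M < M1 by rewrite (le_lt_trans (ler_norm _))// ltrDl.
(* Chosen so that [t *: d] has norm [|z| + M1 + 1]; the triangle inequality then puts the point of
   the ray outside the ball of radius [M1]. *)
pose t := (`|z| + M1 + 1) / `|d|.
have t0 : 0 <= t by rewrite divr_ge0// !addr_ge0.
have /= := bd _ M1M _ (rC _ (ex_intro2 _ _ t t0 erefl)).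
apply/negP; rewrite -ltNge.
have : `|t *: d| <= `|z + t *: d| + `|z|.
  by rewrite -{1}(addKr z (t *: d)) addrC (le_trans (ler_normB _ _)).
rewrite normrZ ger0_norm// divfK ?gt_eqF//; lra.
Qed.

(* A connected set avoiding U and meeting P has clopen trace on P. *)
Lemma component_region U P z : open P -> connected P -> P `<=` ~` U ->
  closure P `<=` P `|` U -> P z -> connected_component (~` U) z = P.
Proof.
move=> oP cP PU cPU Pz; apply/seteqP; split; last first.
  exact: connected_component_max.
have CU : connected_component (~` U) z `<=` ~` U.
  exact: connected_component_sub.
have zC : connected_component (~` U) z z.
  by apply: connected_component_refl; exact: PU.
suff <- : connected_component (~` U) z `&` P = connected_component (~` U) z.
  by move=> ? [].
apply: (@component_connected _ (~` U) z); first by exists z.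
  by exists P.
exists (closure P); first exact: closed_closure.
apply/seteqP; split=> x [xC xP]; split=> //; first exact: subset_closure.
by have [//|/(CU _ xC)] := cPU _ xP.
Qed.

(** Closedness of [A] gives one inclusion; for the other, a point of [A] moved slightly towards [c]
    falls into [P]. *)
Lemma closure_region P A c : closed A -> P `<=` A ->
  (forall z t, A z -> 0 < t -> t <= 1 -> P (z + t *: (c - z))) ->
  closure P = A.
Proof.
move=> clA PA inP; apply/seteqP; split.
  by rewrite [X in _ `<=` X](closure_id A).1//; exact: closure_subset.
move=> z Az B Bz.
have : \forall t \near (0 : R), B (z + t *: (c - z)).
  have := @line_continuous z (c - z) 0.
  by rewrite /prop_for /continuous_at scale0r addr0; apply.
move=> [e /= e0 eB].
pose t := Num.min (e / 2) 1.
have t0 : 0 < t by rewrite lt_min divr_gt0// ltr01.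
exists (z + t *: (c - z)); split; first by apply: inP; rewrite // ge_min lexx orbT.
apply: eB => /=; rewrite sub0r normrN gtr0_norm//.
by rewrite gt_min ltr_pdivrMr// mulr_natr mulr2n ltrDl e0.
Qed.

Definition affine (f : V -> R) :=
  forall z w t, f (z + t *: (w - z)) = f z + t * (f w - f z).

(** * Finite intersections of half-spaces *)

Section Polyhedron.
Variables (n : nat) (F : 'I_n -> V -> R).
Hypotheses (affF : forall i, affine (F i)) (contF : forall i, continuous (F i)).

Definition open_poly : set V := [set z | forall i, 0 < F i z].
Definition closed_poly : set V := [set z | forall i, 0 <= F i z].

Lemma open_open_poly : open open_poly.
Proof.
rewrite openE => z Fz; apply: filter_forall => i.
have Fpos : nbhs (F i z) [set x | 0 < x].
  by apply: open_nbhs_nbhs; split; [exact: open_gt|exact: Fz].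
exact: (contF Fpos).
Qed.

Lemma closed_closed_poly : closed closed_poly.
Proof.
rewrite (_ : closed_poly = \bigcap_i (F i @^-1` [set x | 0 <= x])).
  apply: closed_bigI => i _; apply: closed_comp => [z _|]; first exact: contF.
  exact: closed_ge.
by apply/seteqP; split=> z Fz i; [move=> _|]; apply: Fz.
Qed.

Lemma open_poly_connected c : open_poly c -> connected open_poly.
Proof.
move=> Fc; apply: (star_connected Fc) => z t Fz /andP[t0 t1] i.
by rewrite affF; have := Fc i; have := Fz i; nra.
Qed.

Lemma closure_open_poly c : open_poly c -> closure open_poly = closed_poly.
Proof.
move=> Fc; apply: (@closure_region _ _ c) => [|z Fz i|z t Fz t0 t1 i].
- exact: closed_closed_poly.
- exact: ltW (Fz i).
- by rewrite affF; have := Fc i; have := Fz i; nra.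
Qed.

Lemma frontier_open_poly c : open_poly c ->
  closure open_poly `\` interior open_poly = closed_poly `\` open_poly.
Proof.
move=> Fc; rewrite (closure_open_poly Fc).
by rewrite (interior_id _).1//; exact: open_open_poly.
Qed.

Lemma component_open_poly U z : open_poly z -> open_poly `<=` ~` U ->
  closed_poly `\` open_poly `<=` U -> connected_component (~` U) z = open_poly.
Proof.
move=> Fz FU clU; apply: component_region => //.
- exact: open_open_poly.
- exact: open_poly_connected Fz.
- rewrite (closure_open_poly Fz) => x Fx.
  by have [|nFx] := pselect (open_poly x); [left|right; apply: clU].
Qed.

End Polyhedron.
End Topology.

Lemma continuous_affine_comb (R : realType) (T : topologicalType)
    (f g : T -> R) (a b c : R) : continuous f -> continuous g ->
  continuous (fun z => a * f z + b * g z + c).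
Proof.
move=> cf cg z; apply: cvgD; last exact: cvg_cst.
by apply: cvgD; apply: cvgMl_tmp; [exact: cf|exact: cg].
Qed.

(** Case analysis on indices. The notations [i1], ..., [i4] carry [isT] as bound proof, hence the
    appeal to irrelevance. *)
Lemma forall_I4 (P : 'I_4 -> Prop) : P i1 -> P i2 -> P i3 -> P i4 -> forall i, P i.
Proof.
by move=> P1 P2 P3 P4 [[|[|[|[|//]]]] h]; rewrite (bool_irrelevance h isT).
Qed.

(** * Segments in the plane *)

Section Plane.
Variable R : realType.
Implicit Types (z w u v : 'rV[R]_2) (s : 'rV[R]_2 * 'rV[R]_2).

Lemma rV2P z w : z 0 0 = w 0 0 -> z 0 1 = w 0 1 -> z = w.
Proof.
move=> h0 h1; apply/matrixP => i j; rewrite (ord1 i).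
by case: j => [[|[|//]]] h; [move: h0|move: h1]; congr (z 0 _ = w 0 _);
  apply: val_inj.
Qed.

(** The determinant, nonzero exactly when [u] and [v] form a basis. *)
Definition cross u v : R := u 0 0 * v 0 1 - u 0 1 * v 0 0.

Lemma segE s z :
  seg s z <-> exists2 t, 0 <= t <= 1 & z = s.1 + t *: (s.2 - s.1).
Proof.
have E t : (1 - t) *: s.1 + t *: s.2 = s.1 + t *: (s.2 - s.1).
  by rewrite scalerBl scale1r scalerBr addrAC addrA.
by split=> [[t]|[t t01 ->]]; [rewrite /= in_itv/= => t01 <-; exists t|
  exists t => //=; rewrite in_itv].
Qed.

Lemma seg1 s : seg s s.1.
Proof. by apply/segE; exists 0; rewrite ?lexx ?ler01// scale0r addr0. Qed.

Lemma seg2 s : seg s s.2.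
Proof. by apply/segE; exists 1; rewrite ?lexx ?ler01// scale1r subrKC. Qed.

Lemma seg_convex s z w t : seg s z -> seg s w -> 0 <= t <= 1 ->
  seg s (z + t *: (w - z)).
Proof.
move=> /segE[a /andP[a0 a1] ->] /segE[b /andP[b0 b1] ->] /andP[t0 t1]; apply/segE.
exists (a + t * (b - a)); first by apply/andP; split; nra.
by apply: rV2P; rewrite !mxE; ring.
Qed.

Lemma sub_seg s z w : seg s z -> seg s w -> seg (z, w) `<=` seg s.
Proof. by move=> sz sw _ /segE[t t01 ->]; exact: seg_convex. Qed.

Lemma segC z w : seg (z, w) = seg (w, z).
Proof.
by apply/seteqP; split; apply: sub_seg;
  [exact: (seg2 (w, z))|exact: (seg1 (w, z))|exact: (seg2 (z, w))|
   exact: (seg1 (z, w))].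
Qed.

(** In the parameter of [s], [f] is a polynomial of degree at most one with two distinct zeros,
    hence zero. *)
Lemma seg_affine0 (f : 'rV[R]_2 -> R) s z w : affine f ->
  seg s z -> seg s w -> z != w -> f z = 0 -> f w = 0 ->
  forall v, seg s v -> f v = 0.
Proof.
move=> aff /segE[a _ ->] /segE[b _ ->] zw; rewrite !aff => fz fw.
move=> v /segE[t _ ->]; rewrite aff.
have ab : a - b != 0 by apply: contraNneq zw => /subr0_eq ->.
have : (a - b) * (f s.2 - f s.1) = 0 by lra.
move=> /eqP; rewrite mulf_eq0 (negbTE ab)/= => /eqP E.
by move: fz; rewrite E; lra.
Qed.

(** * Coordinates adapted to a labelled configuration *)

Section Frame.
Variables (O e1 e2 : 'rV[R]_2) (p q x3 y3 : R).
Hypothesis De : cross e1 e2 != 0.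
Hypotheses (p01 : 0 < p < 1) (q01 : 0 < q < 1).
(** The point with coordinates [x3], [y3] is [P34], the meeting point of the third and fourth lines.
    Moreover [x3] is its parameter from [P23] to [X], and [y3] its parameter from [P41] to [Y]. *)
Hypotheses (x3E : x3 = p - p * y3) (y3E : y3 = q - q * x3).

Definition pt (a b : R) := O + a *: e1 + b *: e2.
(** Cramer's rule in the basis [e1], [e2]. *)
Definition abscissa z := cross (z - O) e2 / cross e1 e2.
Definition ordinate z := cross e1 (z - O) / cross e1 e2.

Lemma pt_coord z : pt (abscissa z) (ordinate z) = z.
Proof.
move: De; rewrite /pt /abscissa /ordinate /cross => h.
by apply: rV2P; rewrite !mxE; field.
Qed.

Lemma abscissa_pt a b : abscissa (pt a b) = a.
Proof. by move: De; rewrite /abscissa /pt /cross => h; rewrite !mxE; field. Qed.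

Lemma ordinate_pt a b : ordinate (pt a b) = b.
Proof. by move: De; rewrite /ordinate /pt /cross => h; rewrite !mxE; field. Qed.

Lemma pt_line a b c d t :
  pt a b + t *: (pt c d - pt a b) = pt (a + t * (c - a)) (b + t * (d - b)).
Proof. by apply: rV2P; rewrite !mxE; ring. Qed.

Lemma seg_ptE a b c d z : seg (pt a b, pt c d) z <->
  exists2 t, 0 <= t <= 1 &
    abscissa z = a + t * (c - a) /\ ordinate z = b + t * (d - b).
Proof.
rewrite segE; split=> -[t t01]; rewrite /= ?pt_line.
  by move=> ->; exists t => //; rewrite abscissa_pt ordinate_pt.
by move=> [h1 h2]; exists t => //; rewrite pt_line -h1 -h2 pt_coord.
Qed.

(* The lines are [y = 0], [x = 0], [q x + y = q] and [x + p y = p]. *)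
Definition line_coef (i : 'I_4) : R * R * R :=
  match val i with
  | 0 => (0, 1, 0) | 1 => (1, 0, 0) | 2 => (q, 1, - q) | _ => (1, p, - p)
  end.

Definition line_form i z :=
  (line_coef i).1.1 * abscissa z + (line_coef i).1.2 * ordinate z
  + (line_coef i).2.

Lemma line_form_affine i : affine (line_form i).
Proof.
move=> z w t; rewrite -(pt_coord z) -(pt_coord w) pt_line /line_form.
by rewrite !abscissa_pt !ordinate_pt; ring.
Qed.

Lemma cross_continuousl v : continuous (cross^~ v).
Proof.
move=> u; have c k := @coord_continuous R 1 2 0 k u.
by apply: (cvgB (cvgMr_tmp (c 0)) (cvgMr_tmp (c 1))).
Qed.

Lemma cross_continuousr u : continuous (cross u).
Proof.
move=> v; have c k := @coord_continuous R 1 2 0 k v.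
by apply: (cvgB (cvgMl_tmp (c 1)) (cvgMl_tmp (c 0))).
Qed.

Lemma abscissa_continuous : continuous abscissa.
Proof.
move=> z; have cO : (w - O) @[w --> z] --> z - O.
  have cvg_sub := @cvgB R 'rV[R]_2 _ (nbhs z) _ id (cst O) z O.
  by apply: cvg_sub; [exact: cvg_id|exact: cvg_cst].
exact: (cvgMr_tmp (continuous_cvg _ (@cross_continuousl e2 (z - O)) cO)).
Qed.

Lemma ordinate_continuous : continuous ordinate.
Proof.
move=> z; have cO : (w - O) @[w --> z] --> z - O.
  have cvg_sub := @cvgB R 'rV[R]_2 _ (nbhs z) _ id (cst O) z O.
  by apply: cvg_sub; [exact: cvg_id|exact: cvg_cst].
exact: (cvgMr_tmp (continuous_cvg _ (@cross_continuousr e1 (z - O)) cO)).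
Qed.

Lemma line_form_continuous i : continuous (line_form i).
Proof.
exact: continuous_affine_comb abscissa_continuous ordinate_continuous.
Qed.

(** * Cells of the line arrangement and their boundaries *)

Definition region_form (sg : 'I_4 -> R) i z := sg i * line_form i z.

Lemma region_form_affine sg i : affine (region_form sg i).
Proof. by move=> z w t; rewrite /region_form line_form_affine; ring. Qed.

Lemma region_form_continuous sg i : continuous (region_form sg i).
Proof. by move=> z; exact: (cvgMl_tmp (@line_form_continuous i z)). Qed.

(** The bounded cells all lie in the open first quadrant, so only the sides of the third and fourth
    lines vary: (-1, -1) is the quadrilateral, (-1, 1) the triangle at [X], (1, -1) the triangle at
    [Y]. *)
Definition signs (c3 c4 : R) (i : 'I_4) : R :=
  match val i with 2 => c3 | 3 => c4 | _ => 1 end.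

Definition region c3 c4 := open_poly (region_form (signs c3 c4)).
Definition cregion c3 c4 := closed_poly (region_form (signs c3 c4)).

Local Notation face_signs := [:: (-1, -1); (-1, 1); (1, -1 : R)].

Lemma regionP c3 c4 z : region c3 c4 z <->
  [/\ 0 < ordinate z, 0 < abscissa z,
      0 < c3 * (q * abscissa z + ordinate z - q) &
      0 < c4 * (abscissa z + p * ordinate z - p)].
Proof.
rewrite /region /region_form /line_form; split=> [h|[h1 h2 h3 h4]].
  by split; [have := h i1|have := h i2|have := h i3|have := h i4];
    rewrite /signs /line_coef /=; lra.
by apply: forall_I4; rewrite /region_form /line_form /signs /line_coef /=; lra.
Qed.

Lemma cregionP c3 c4 z : cregion c3 c4 z <->
  [/\ 0 <= ordinate z, 0 <= abscissa z,
      0 <= c3 * (q * abscissa z + ordinate z - q) &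
      0 <= c4 * (abscissa z + p * ordinate z - p)].
Proof.
rewrite /cregion /region_form /line_form; split=> [h|[h1 h2 h3 h4]].
  by split; [have := h i1|have := h i2|have := h i3|have := h i4];
    rewrite /signs /line_coef /=; lra.
by apply: forall_I4; rewrite /region_form /line_form /signs /line_coef /=; lra.
Qed.

(** The 2 by 2 linear system for [P34], solved without dividing by its determinant. *)
Lemma pt34E :
  x3 * (1 - p * q) = p * (1 - q) /\ y3 * (1 - p * q) = q * (1 - p).
Proof.
have hx : x3 = p - p * (q - q * x3) by rewrite -y3E.
have hy : y3 = q - q * (p - p * y3) by rewrite -x3E.
by split; [move: hx|move: hy]; lra.
Qed.

Lemma p34_bounds : [/\ 0 < x3, x3 < p, 0 < y3 & y3 < q].
Proof.
move: p01 q01 => /andP[p0 p1] /andP[q0 q1].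
have pq : 0 < 1 - p * q by nra.
have [hx hy] := pt34E.
have x0 : 0 < x3 by rewrite -(pmulr_lgt0 _ pq) hx; nra.
have y0 : 0 < y3 by rewrite -(pmulr_lgt0 _ pq) hy; nra.
have := mulr_gt0 p0 y0; have := mulr_gt0 q0 x0.
by move: x3E y3E; split=> //; lra.
Qed.

(** This lemma and the next three turn a comparison with a coordinate of [P34] into a polynomial
    inequality in [p] and [q], suited to [nra]. *)
Lemma pt34_abscissa_le x : (x <= x3) = (x * (1 - p * q) <= p * (1 - q)).
Proof.
have [<- _] := pt34E; rewrite ler_pM2r// subr_gt0.
by move: p01 q01 => /andP[? ?] /andP[? ?]; nra.
Qed.

Lemma pt34_ordinate_le y : (y <= y3) = (y * (1 - p * q) <= q * (1 - p)).
Proof.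
have [_ <-] := pt34E; rewrite ler_pM2r// subr_gt0.
by move: p01 q01 => /andP[? ?] /andP[? ?]; nra.
Qed.

Lemma pt34_abscissa_ge x : (x3 <= x) = (p * (1 - q) <= x * (1 - p * q)).
Proof.
have [<- _] := pt34E; rewrite ler_pM2r// subr_gt0.
by move: p01 q01 => /andP[? ?] /andP[? ?]; nra.
Qed.

Lemma pt34_ordinate_ge y : (y3 <= y) = (q * (1 - p) <= y * (1 - p * q)).
Proof.
have [_ <-] := pt34E; rewrite ler_pM2r// subr_gt0.
by move: p01 q01 => /andP[? ?] /andP[? ?]; nra.
Qed.

Lemma div01 (a b : R) : 0 <= a -> a <= b -> 0 < b -> 0 <= a / b <= 1.
Proof. by move=> a0 ab b0; rewrite ler_pdivrMr// mul1r ab divr_ge0// ltW. Qed.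

(** Collinearity plus a range for one coordinate. Vertical segments call for the variant
    [seg_ordinate]. *)
Lemma seg_abscissa a b c d z : a < c -> a <= abscissa z <= c ->
  (ordinate z - b) * (c - a) = (abscissa z - a) * (d - b) ->
  seg (pt a b, pt c d) z.
Proof.
move=> ac /andP[az zc] E; have ca : 0 < c - a by rewrite subr_gt0.
apply/seg_ptE; exists ((abscissa z - a) / (c - a)).
  by apply: div01 => //; lra.
split; first by field; lra.
by rewrite mulrAC -E mulfK ?gt_eqF// subrKC.
Qed.

Lemma seg_ordinate a b c d z : b < d -> b <= ordinate z <= d ->
  (abscissa z - a) * (d - b) = (ordinate z - b) * (c - a) ->
  seg (pt a b, pt c d) z.
Proof.
move=> bd /andP[bz zd] E; have db : 0 < d - b by rewrite subr_gt0.
apply/seg_ptE; exists ((ordinate z - b) / (d - b)).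
  by apply: div01 => //; lra.
split; last by field; lra.
by rewrite mulrAC -E mulfK ?gt_eqF// subrKC.
Qed.

(** The closed cell is convex, and the form [i] vanishes along the segment, which violates the
    strict inequality of index [i]. *)
Lemma seg_sub_frontier c3 c4 i a b c d :
  cregion c3 c4 (pt a b) -> cregion c3 c4 (pt c d) ->
  line_form i (pt a b) = 0 -> line_form i (pt c d) = 0 ->
  seg (pt a b, pt c d) `<=` cregion c3 c4 `\` region c3 c4.
Proof.
move=> cA cB LA LB z /segE[t /andP[t0 t1] ->]; split=> [j|/(_ i)].
  by rewrite region_form_affine/=; have := cA j; have := cB j; nra.
by rewrite /region_form line_form_affine/= LA LB subrr !mulr0 addr0 mulr0 ltxx.
Qed.

Lemma frontierP c3 c4 z : (cregion c3 c4 `\` region c3 c4) z ->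
  [/\ 0 <= ordinate z, 0 <= abscissa z,
      0 <= c3 * (q * abscissa z + ordinate z - q) &
      0 <= c4 * (abscissa z + p * ordinate z - p)] /\
  [\/ ordinate z = 0, abscissa z = 0,
      c3 * (q * abscissa z + ordinate z - q) = 0 |
      c4 * (abscissa z + p * ordinate z - p) = 0].
Proof.
move=> [/cregionP[h1 h2 h3 h4] /regionP nr]; split=> //.
move: h1 h2 h3 h4 nr; rewrite !le_eqVlt.
by do 4![case/predU1P=> [?|?]; first by (constructor 1 + constructor 2 +
  constructor 3 + constructor 4)] => -[].
Qed.

(** A form that vanishes puts the point on the line of one side, and the other inequalities confine
    it between the two vertices there. Conversely it is enough to check the vertices, by
    [seg_sub_frontier]. *)
Lemma quad_frontier : cregion (-1) (-1) `\` region (-1) (-1) =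
  seg (pt p 0, pt 0 0) `|` seg (pt 0 0, pt 0 q) `|` seg (pt 0 q, pt x3 y3)
  `|` seg (pt x3 y3, pt p 0).
Proof.
have [p0 p1] := andP p01; have [q0 q1] := andP q01.
have [x30 x3p y30 y3q] := p34_bounds; have := x3E; have := y3E => y3e x3e.
apply/seteqP; split=> [z /frontierP[]|].
  move=> [h1 h2 h3 h4] [] E.
  - left; left; left; rewrite segC; apply: seg_abscissa; rewrite ?E; nra.
  - left; left; right; apply: seg_ordinate; rewrite ?E; nra.
  - left; right; apply: seg_abscissa => //; last by nra.
    by rewrite h2 pt34_abscissa_le; nra.
  - right; apply: seg_abscissa => //; last by nra.
    by rewrite pt34_abscissa_ge; nra.
have cO : cregion (-1) (-1) (pt 0 0).
  by apply/cregionP; rewrite abscissa_pt ordinate_pt; split; nra.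
have cP : cregion (-1) (-1) (pt p 0).
  by apply/cregionP; rewrite abscissa_pt ordinate_pt; split; nra.
have cQ : cregion (-1) (-1) (pt 0 q).
  by apply/cregionP; rewrite abscissa_pt ordinate_pt; split; nra.
have c34 : cregion (-1) (-1) (pt x3 y3).
  by apply/cregionP; rewrite abscissa_pt ordinate_pt; split; nra.
rewrite !subUset; split; [split; [split|]|];
  [apply: (@seg_sub_frontier _ _ i1)|apply: (@seg_sub_frontier _ _ i2)|
   apply: (@seg_sub_frontier _ _ i3)|apply: (@seg_sub_frontier _ _ i4)] => //;
  rewrite /line_form /line_coef/= abscissa_pt ordinate_pt; lra.
Qed.

Lemma triangle1_frontier : cregion (-1) 1 `\` region (-1) 1 =
  seg (pt x3 y3, pt p 0) `|` seg (pt p 0, pt 1 0) `|` seg (pt x3 y3, pt 1 0).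
Proof.
have [p0 p1] := andP p01; have [q0 q1] := andP q01.
have [x30 x3p y30 y3q] := p34_bounds; have := x3E; have := y3E => y3e x3e.
apply/seteqP; split=> [z /frontierP[]|].
  move=> [h1 h2 h3 h4] [] E.
  - left; right; apply: seg_abscissa; rewrite ?E; nra.
  (* The line [x = 0] misses this triangle: the last two inequalities would give [1 <= y <= q]. *)
  - by exfalso; nra.
  - right; apply: seg_abscissa => //; [lra| |by nra].
    by rewrite pt34_abscissa_ge; nra.
  - left; left; rewrite segC; apply: seg_ordinate => //; last by nra.
    by rewrite pt34_ordinate_le; nra.
have cP : cregion (-1) 1 (pt p 0).
  by apply/cregionP; rewrite abscissa_pt ordinate_pt; split; nra.
have cX : cregion (-1) 1 (pt 1 0).
  by apply/cregionP; rewrite abscissa_pt ordinate_pt; split; nra.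
have c34 : cregion (-1) 1 (pt x3 y3).
  by apply/cregionP; rewrite abscissa_pt ordinate_pt; split; nra.
rewrite !subUset; split; [split|];
  [apply: (@seg_sub_frontier _ _ i4)|apply: (@seg_sub_frontier _ _ i1)|
   apply: (@seg_sub_frontier _ _ i3)] => //;
  rewrite /line_form /line_coef/= abscissa_pt ordinate_pt; lra.
Qed.

Lemma triangle2_frontier : cregion 1 (-1) `\` region 1 (-1) =
  seg (pt 0 q, pt x3 y3) `|` seg (pt 0 q, pt 0 1) `|` seg (pt x3 y3, pt 0 1).
Proof.
have [p0 p1] := andP p01; have [q0 q1] := andP q01.
have [x30 x3p y30 y3q] := p34_bounds; have := x3E; have := y3E => y3e x3e.
apply/seteqP; split=> [z /frontierP[]|].
  move=> [h1 h2 h3 h4] [] E.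
  - by exfalso; nra.
  - left; right; apply: seg_ordinate; rewrite ?E; nra.
  - left; left; apply: seg_abscissa => //; last by nra.
    by rewrite h2 pt34_abscissa_le; nra.
  - right; apply: seg_ordinate => //; [lra| |by nra].
    by rewrite pt34_ordinate_ge; nra.
have cQ : cregion 1 (-1) (pt 0 q).
  by apply/cregionP; rewrite abscissa_pt ordinate_pt; split; nra.
have cY : cregion 1 (-1) (pt 0 1).
  by apply/cregionP; rewrite abscissa_pt ordinate_pt; split; nra.
have c34 : cregion 1 (-1) (pt x3 y3).
  by apply/cregionP; rewrite abscissa_pt ordinate_pt; split; nra.
rewrite !subUset; split; [split|];
  [apply: (@seg_sub_frontier _ _ i3)|apply: (@seg_sub_frontier _ _ i2)|
   apply: (@seg_sub_frontier _ _ i4)] => //;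
  rewrite /line_form /line_coef/= abscissa_pt ordinate_pt; lra.
Qed.

(** * Bounded faces of the four segments *)

Variable T : 'I_4 -> 'rV[R]_2 * 'rV[R]_2.

(** The outer two of the three crossings on each line. The segment may extend beyond them, so they
    are only assumed to belong to it. *)
Definition endA (i : 'I_4) :=
  match val i with 2 => pt 0 q | 3 => pt p 0 | _ => pt 0 0 end.
Definition endB (i : 'I_4) :=
  match val i with 0 => pt 1 0 | 2 => pt 1 0 | _ => pt 0 1 end.

Hypotheses (TA : forall i, seg (T i) (endA i)) (TB : forall i, seg (T i) (endB i)).

Let U := \bigcup_i seg (T i).

Lemma pt_inj a b c d : pt a b = pt c d -> a = c /\ b = d.
Proof.
move=> E; split; first by rewrite -(abscissa_pt a b) E abscissa_pt.
by rewrite -(ordinate_pt a b) E ordinate_pt.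
Qed.

Lemma endAB i : endA i != endB i.
Proof.
by move: i; apply: forall_I4; apply/eqP => /= /pt_inj[]; have := p01; have := q01; lra.
Qed.

Lemma line_form_endA i : line_form i (endA i) = 0.
Proof.
by move: i; apply: forall_I4;
  rewrite /line_form /line_coef /endA /= abscissa_pt ordinate_pt; ring.
Qed.

Lemma line_form_endB i : line_form i (endB i) = 0.
Proof.
by move: i; apply: forall_I4;
  rewrite /line_form /line_coef /endB /= abscissa_pt ordinate_pt; ring.
Qed.

Lemma line_form_seg i z : seg (T i) z -> line_form i z = 0.
Proof.
apply: (seg_affine0 (@line_form_affine i) (TA i) (TB i) (endAB i)).
- exact: line_form_endA.
- exact: line_form_endB.
Qed.

(** Every crossing on the line [j] lies between its outer two, so these are weakly separated by each
    other line. *)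
Lemma line_form_cross i j : i != j ->
  line_form i (endA j) * line_form i (endB j) <= 0 /\
  line_form i (endA j) != line_form i (endB j).
Proof.
have [p0 p1] := andP p01; have [q0 q1] := andP q01.
have hq : 0 <= q * (1 - p) * (1 - q) by rewrite !mulr_ge0 ?subr_ge0 ?ltW.
have hp : 0 <= p * (1 - q) * (1 - p) by rewrite !mulr_ge0 ?subr_ge0 ?ltW.
move: i j; apply: forall_I4; apply: forall_I4 => // _;
  rewrite /line_form /line_coef /endA /endB /= !(abscissa_pt, ordinate_pt);
  (split; [nra|apply/eqP; nra]).
Qed.

(** * Rays escaping to infinity *)

Lemma line_formE i z : line_form i z = 0 ->
  exists r, z = endA i + r *: (endB i - endA i).
Proof.
rewrite -{2}(pt_coord z) /line_form.
move: i; apply: forall_I4; rewrite /line_coef /endA /endB /= => E;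
  [exists (abscissa z)|exists (ordinate z)|exists (abscissa z)|exists (ordinate z)];
  rewrite pt_line; congr pt; lra.
Qed.

(** Beyond [A] the line [j] meets no other line, since all its crossings lie between [A] and [B];
    and it cannot come back into its own segment, which is convex and contains [A]. *)
Lemma ray_beyond_end j A B r : A != B -> seg (T j) A -> seg (T j) B ->
  (forall i, i != j -> line_form i A * line_form i B <= 0 /\
                       line_form i A != line_form i B) ->
  ~ U (A + r *: (B - A)) -> r < 0 ->
  exists2 d, d != 0 & forall t, 0 <= t -> ~ U (A + r *: (B - A) + t *: d).
Proof.
move=> AB jA jB hAB nU r0; exists (A - B); first by rewrite subr_eq0.
move=> t t0 [i _].
have -> : A + r *: (B - A) + t *: (A - B) = A + (r - t) *: (B - A).
  by apply: rV2P; rewrite !mxE; ring.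
have [->|ij] := eqVneq i j.
  move=> jw; apply: nU; exists j => //.
  have rt : r - t < 0 by lra.
  (* This parameter brings the farther point back to the starting point on the way to [A]. *)
  have := @seg_convex _ _ _ (t / (t - r)) jw jA.
  have -> : A + (r - t) *: (B - A) + (t / (t - r)) *: (A - (A + (r - t) *: (B - A)))
    = A + r *: (B - A).
    by apply: rV2P; rewrite !mxE; field; lra.
  by apply; apply: div01; lra.
move=> /line_form_seg; rewrite line_form_affine.
have [h1 /eqP h2] := hAB i ij => E; apply: h2.
move: h1 E; move: (line_form i A) (line_form i B) => x y xy E.
(* Both factors [1 + t - r] and [t - r] are positive, so [x] and [y] have the same sign, while their
   product is nonpositive: both vanish, against [h2]. *)
have xE : x * (1 + t - r) = (t - r) * y by lra.
have y0 : y = 0.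
  apply/eqP; rewrite -sqrf_eq0 eq_le sqr_ge0 andbT.
  rewrite -(@pmulr_rle0 _ (t - r)); last by lra.
  have -> : (t - r) * y ^+ 2 = x * y * (1 + t - r) by rewrite expr2 mulrA -xE; ring.
  by rewrite pmulr_lle0//; lra.
move: xE; rewrite y0 mulr0 => /eqP; rewrite mulf_eq0 => /orP[/eqP//|/eqP]; lra.
Qed.

(** The point has parameter [r < 0] or [r > 1] on the line [j]; the second case is the first with
    the ends exchanged. *)
Lemma ray_on_line j z : ~ U z -> line_form j z = 0 ->
  exists2 d, d != 0 & forall t, 0 <= t -> ~ U (z + t *: d).
Proof.
move=> nU /line_formE[r zE].
have [r0|r0] := ltP r 0.
  rewrite zE in nU *; apply: (@ray_beyond_end j) => //; first exact: endAB.
  by move=> i ij; exact: line_form_cross.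
have [r1|r1] := ltP 1 r; last first.
  exfalso; apply: nU; exists j => //; rewrite zE; apply: seg_convex => //.
  exact/andP.
have zE' : z = endB j + (1 - r) *: (endA j - endB j).
  by rewrite zE; apply: rV2P; rewrite !mxE; ring.
rewrite zE' in nU *; apply: (@ray_beyond_end j) => //.
- by rewrite eq_sym endAB.
- by move=> i ij; rewrite mulrC eq_sym; exact: line_form_cross.
- lra.
Qed.

(** The vector with coordinates [a], [b] is a recession direction of the cell of [z]: no form moves
    towards zero along it. *)
Lemma escape_direction z : (forall i, line_form i z != 0) ->
  ~ region (-1) (-1) z -> ~ region (-1) 1 z -> ~ region 1 (-1) z ->
  exists a b, (a != 0) || (b != 0) /\
    forall i, 0 <= line_form i z *
      ((line_coef i).1.1 * a + (line_coef i).1.2 * b).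
Proof.
have [p0 p1] := andP p01; have [q0 q1] := andP q01.
move=> nz /regionP nQ /regionP n1 /regionP n2.
have dir a b : (a != 0) || (b != 0) ->
    0 <= ordinate z * b -> 0 <= abscissa z * a ->
    0 <= (q * abscissa z + ordinate z - q) * (q * a + b) ->
    0 <= (abscissa z + p * ordinate z - p) * (a + p * b) ->
  exists a b, (a != 0) || (b != 0) /\
    forall i, 0 <= line_form i z *
      ((line_coef i).1.1 * a + (line_coef i).1.2 * b).
  move=> ab h1 h2 h3 h4; exists a, b; split=> //.
  by apply: forall_I4; rewrite /line_form /line_coef /=; lra.
have : ordinate z != 0.
  have := nz i1.
  by rewrite /line_form /line_coef /= !(mul0r, mul1r, add0r, addr0).
have : abscissa z != 0.
  have := nz i2.
  by rewrite /line_form /line_coef /= !(mul0r, mul1r, add0r, addr0).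
have : q * abscissa z + ordinate z - q != 0.
  have := nz i3.
  by rewrite /line_form /line_coef /= !(mul0r, mul1r, add0r, addr0).
have : abscissa z + p * ordinate z - p != 0.
  have := nz i4.
  by rewrite /line_form /line_coef /= !(mul0r, mul1r, add0r, addr0).
move: dir nQ n1 n2; move: (abscissa z) (ordinate z) => x y dir nQ n1 n2.
have pq : 0 < 1 - p * q by nra.
(* Sixteen sign patterns, negative before positive: eight unbounded cells with an explicit
   direction, the three excluded bounded cells, and five inconsistent patterns. *)
rewrite !neq_lt => /orP[f4s|f4s] /orP[f3s|f3s] /orP[xs|xs] /orP[ys|ys].
- apply: (dir (-1) (-1)); rewrite ?oppr_eq0 ?oner_eq0//; nra.
- apply: (dir (-1) 0); rewrite ?oppr_eq0 ?oner_eq0//; nra.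
- apply: (dir 0 (-1)); rewrite ?oppr_eq0 ?oner_eq0 ?orbT//; nra.
- by exfalso; apply: nQ; split; lra.
- exfalso; nra.
- apply: (dir (-1) 1); rewrite ?oppr_eq0 ?oner_eq0//; nra.
- exfalso.
  (* Eliminating [x] between the two forms gives [y * (1 - p * q) > q * (1 - p) > 0], although
     [y < 0]. *)
  have : (y * (1 - p * q)) <= 0 by rewrite mulr_le0_ge0 ?ltW.
  by have : q * (x + p * y - p) < 0 by [rewrite pmulr_rlt0]; nra.
- by exfalso; apply: n2; split; lra.
- exfalso; nra.
- exfalso.
  have : (x * (1 - p * q)) <= 0 by rewrite mulr_le0_ge0 ?ltW.
  by have : p * (q * x + y - q) < 0 by [rewrite pmulr_rlt0]; nra.
- apply: (dir 1 (-1)); rewrite ?oppr_eq0 ?oner_eq0//; nra.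
- by exfalso; apply: n1; split; lra.
- exfalso; nra.
- apply: (dir 0 1); rewrite ?oppr_eq0 ?oner_eq0 ?orbT//; nra.
- apply: (dir 1 0); rewrite ?oppr_eq0 ?oner_eq0//; nra.
- apply: (dir 1 1); rewrite ?oppr_eq0 ?oner_eq0//; nra.
Qed.

Lemma ray_off_lines z : (forall i, line_form i z != 0) ->
  ~ region (-1) (-1) z -> ~ region (-1) 1 z -> ~ region 1 (-1) z ->
  exists2 d, d != 0 & forall t, 0 <= t -> ~ U (z + t *: d).
Proof.
move=> nz nQ n1 n2; have [a [b [ab h]]] := escape_direction nz nQ n1 n2.
exists (a *: e1 + b *: e2).
  apply: contraTneq ab => E.
  have [] : a = 0 /\ b = 0.
    by apply: pt_inj; rewrite /pt -addrA E !scale0r !addr0.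
  by move=> -> ->; rewrite eqxx.
move=> t t0 [i _] /line_form_seg.
have -> : z + t *: (a *: e1 + b *: e2) =
    pt (abscissa z + t * a) (ordinate z + t * b).
  by rewrite -{1}(pt_coord z); apply: rV2P; rewrite !mxE; ring.
have := h i; have := nz i.
rewrite /line_form abscissa_pt ordinate_pt.
move: (line_coef i) => [[u v] w] /=.
set f := u * abscissa z + _ + _ => f0 fd E.
(* If the form vanished at time [t], its initial value [f] would be [- t] times its slope, whereas
   [f] times the slope is nonnegative. *)
have : f ^+ 2 <= 0.
  have -> : f ^+ 2 = - t * (f * (u * a + v * b)) by rewrite /f in fd E *; nra.
  by rewrite mulNr oppr_le0 mulr_ge0.
by apply/negP; rewrite -ltNge exprn_even_gt0.
Qed.

Lemma region_coord_bound c3 c4 z :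
  (c3, c4) \in face_signs ->
  region c3 c4 z -> 0 < abscissa z < 1 /\ 0 < ordinate z < 1.
Proof.
have [p0 p1] := andP p01; have [q0 q1] := andP q01.
rewrite !inE => /or3P[] /eqP[-> ->] /regionP[h1 h2 h3 h4]; split; nra.
Qed.

Lemma region_bounded c3 c4 :
  (c3, c4) \in face_signs ->
  bounded_set (region c3 c4).
Proof.
move=> c34; exists (`|O| + `|e1| + `|e2|); split; first exact: num_real.
move=> M ltM z /= /(region_coord_bound c34)[/andP[x0 x1] /andP[y0 y1]].
apply: le_trans (ltW ltM); rewrite -(pt_coord z) /pt.
apply: (le_trans (ler_normD _ _)); apply: lerD.
  apply: (le_trans (ler_normD _ _)); apply: lerD => //.
  by rewrite normrZ gtr0_norm// ler_piMl// ltW.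
by rewrite normrZ gtr0_norm// ler_piMl// ltW.
Qed.

Lemma region_nonempty c3 c4 :
  (c3, c4) \in face_signs ->
  region c3 c4 !=set0.
Proof.
have [p0 p1] := andP p01; have [q0 q1] := andP q01.
have [x30 x3p y30 y3q] := p34_bounds; have := x3E; have := y3E => y3e x3e.
rewrite !inE => /or3P[] /eqP[-> ->].
(* The witnesses are the midpoint of [P12] and [P34], then the centroids of the two triangles. *)
- exists (pt (x3 / 2) (y3 / 2)); apply/regionP.
  by rewrite abscissa_pt ordinate_pt; split; lra.
- exists (pt ((x3 + p + 1) / 3) (y3 / 3)); apply/regionP.
  by rewrite abscissa_pt ordinate_pt; split; nra.
- exists (pt (x3 / 3) ((y3 + q + 1) / 3)); apply/regionP.
  by rewrite abscissa_pt ordinate_pt; split; nra.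
Qed.

Lemma sides_sub : [/\ U (pt 0 0), seg (T i1) (pt p 0), seg (T i2) (pt 0 q),
  seg (T i3) (pt x3 y3) & seg (T i4) (pt x3 y3)].
Proof.
have [p0 p1] := andP p01; have [q0 q1] := andP q01.
have [x30 x3p y30 y3q] := p34_bounds; have := x3E; have := y3E => y3e x3e.
split; first by exists i1 => //; exact: (TA i1).
- apply: (sub_seg (TA i1) (TB i1)); apply: seg_abscissa;
    rewrite ?abscissa_pt ?ordinate_pt; lra.
- apply: (sub_seg (TA i2) (TB i2)); apply: seg_ordinate;
    rewrite ?abscissa_pt ?ordinate_pt; lra.
- apply: (sub_seg (TA i3) (TB i3)); apply: seg_abscissa;
    rewrite ?abscissa_pt ?ordinate_pt; nra.
- apply: (sub_seg (TA i4) (TB i4)); apply: seg_ordinate;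
    rewrite ?abscissa_pt ?ordinate_pt; nra.
Qed.

Lemma signs_neq0 (c3 c4 : R) :
  (c3, c4) \in face_signs -> c3 != 0 /\ c4 != 0.
Proof. by rewrite !inE => /or3P[] /eqP[-> ->]; rewrite ?oppr_eq0 oner_eq0. Qed.

Lemma region_sub c3 c4 : c3 != 0 -> c4 != 0 -> region c3 c4 `<=` ~` U.
Proof.
move=> c30 c40 z rz [i _ /line_form_seg E].
by have := rz i; rewrite /region_form E mulr0 ltxx.
Qed.

Lemma component_region_frame c3 c4 z :
  (c3, c4) \in face_signs ->
  region c3 c4 z -> connected_component (~` U) z = region c3 c4.
Proof.
move=> c34 rz.
have [c30 c40] := signs_neq0 c34.
have [UO Up Uq U3 U4] := sides_sub.
have sub i w v : seg (T i) w -> seg (T i) v -> seg (w, v) `<=` U.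
  by move=> iw iv u /(sub_seg iw iv) iu; exists i.
apply: component_open_poly => //.
- exact: region_form_affine.
- exact: region_form_continuous.
- exact: region_sub.
change (cregion c3 c4 `\` region c3 c4 `<=` U).
have := c34; rewrite !inE => /or3P[] /eqP[-> ->].
- rewrite quad_frontier !subUset; split; [split; [split|]|].
  + exact: (sub i1 _ _ Up (TA i1)).
  + exact: (sub i2 _ _ (TA i2) Uq).
  + exact: (sub i3 _ _ (TA i3) U3).
  + exact: (sub i4 _ _ U4 (TA i4)).
- rewrite triangle1_frontier !subUset; split; [split|].
  + exact: (sub i4 _ _ U4 (TA i4)).
  + exact: (sub i1 _ _ Up (TB i1)).
  + exact: (sub i3 _ _ U3 (TB i3)).
- rewrite triangle2_frontier !subUset; split; [split|].
  + exact: (sub i3 _ _ (TA i3) U3).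
  + exact: (sub i2 _ _ Uq (TB i2)).
  + exact: (sub i4 _ _ U4 (TB i4)).
Qed.

Lemma bounded_faces_frame :
  bounded_faces T = [set region (-1) (-1); region (-1) 1; region 1 (-1)].
Proof.
have face c3 c4 : (c3, c4) \in face_signs ->
    bounded_faces T (region c3 c4).
  move=> c34; split; first exact: region_bounded.
  have [z rz] := region_nonempty c34; exists z.
    by have [? ?] := signs_neq0 c34; exact: region_sub rz.
  by rewrite (component_region_frame c34 rz).
apply/seteqP; split=> [F [bF [z nUz FE]]|F [[]|] ->]; last 3 first.
- by apply: face; rewrite !inE eqxx.
- by apply: face; rewrite !inE eqxx orbT.
- by apply: face; rewrite !inE eqxx !orbT.
rewrite FE in bF *.
have [rz|nQ] := pselect (region (-1) (-1) z).
  by left; left; apply: component_region_frame; rewrite ?inE ?eqxx.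
have [rz|n1] := pselect (region (-1) 1 z).
  by left; right; apply: component_region_frame; rewrite ?inE ?eqxx ?orbT.
have [rz|n2] := pselect (region 1 (-1) z).
  by right; apply: component_region_frame; rewrite ?inE ?eqxx ?orbT.
suff [d d0 dU] : exists2 d, d != 0 & forall t, 0 <= t -> ~ U (z + t *: d).
  by case: (ray_unbounded d0 dU bF).
have [nz|] := pselect (forall i, line_form i z != 0); first exact: ray_off_lines.
move=> /existsNP[i /negP/negPn/eqP zi]; exact: ray_on_line zi.
Qed.

Lemma frontier_region c3 c4 :
  (c3, c4) \in face_signs ->
  frontier (region c3 c4) = cregion c3 c4 `\` region c3 c4.
Proof.
move=> c34; have [z rz] := region_nonempty c34; apply: frontier_open_poly rz.
- exact: region_form_affine.
- exact: region_form_continuous.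
Qed.

Lemma bound_quad_and_triangles_frame :
  bound_quad_and_triangles T
    (Vertices (pt 0 0) (pt 0 q) (pt x3 y3) (pt p 0) (pt 1 0) (pt 0 1)).
Proof.
exists (region (-1) (-1)), (region (-1) 1), (region 1 (-1)); split.
- exact: bounded_faces_frame.
- rewrite frontier_region ?inE ?eqxx// quad_frontier.
  apply/seteqP; split=> [z [[[]|]|]|z [+ _]].
  + by exists i1.
  + by exists i2.
  + by exists i3.
  + by exists i4.
  + apply: forall_I4; rewrite /sideA /tnth/= => h.
    * by left; left; left.
    * by left; left; right.
    * by left; right.
    * by right.
- by rewrite frontier_region ?inE ?eqxx ?orbT// triangle1_frontier.
- by rewrite frontier_region ?inE ?eqxx ?orbT// triangle2_frontier.
Qed.

End Frame.

(** * Length ratios *)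

Lemma dist_line z w a c :
  dist (z + a *: (w - z)) (z + c *: (w - z)) = `|a - c| * dist z w.
Proof.
rewrite /dist -(sqrtr_sqr (a - c)) -sqrtrM ?sqr_ge0//; congr Num.sqrt.
by rewrite mulr_sumr; apply: eq_bigr => k _; rewrite !mxE; ring.
Qed.

Lemma distC z w : dist z w = dist w z.
Proof. by congr Num.sqrt; apply: eq_bigr => k _; rewrite -sqrrN opprB. Qed.

Lemma dist_gt0 z w : z != w -> 0 < dist z w.
Proof.
move=> zw; rewrite sqrtr_gt0 lt0r sumr_ge0 ?andbT; last by move=> k _; exact: sqr_ge0.
apply: contraNneq zw => /eqP; rewrite psumr_eq0; last by move=> k _; exact: sqr_ge0.
by move=> /allP h; apply/eqP/matrixP => i j; rewrite (ord1 i); apply/eqP;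
  rewrite -subr_eq0 -sqrf_eq0; exact: (h j (mem_index_enum _)).
Qed.

Lemma dist_ratio z w t : z != w -> 0 < t < 1 ->
  0 < dist z (z + t *: (w - z)) /\
  dist (z + t *: (w - z)) w / dist z (z + t *: (w - z)) = (1 - t) / t.
Proof.
move=> /dist_gt0 zw /andP[t0 t1].
have E1 : dist z (z + t *: (w - z)) = t * dist z w.
  by have := dist_line z w 0 t; rewrite scale0r addr0 sub0r normrN gtr0_norm.
have E2 : dist (z + t *: (w - z)) w = (1 - t) * dist z w.
  have := dist_line z w t 1.
  by rewrite scale1r subrKC distrC gtr0_norm// subr_gt0.
rewrite E1 E2; split; first exact: mulr_gt0.
by field; rewrite !gt_eqF.
Qed.

(** On each line [A_i] is followed by [B_i] from one outer crossing to the other, and their common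
    point has parameter [p], [q], [x3] or [y3]; [dist_ratio] then applies. *)
Lemma ratios_frame O e1 e2 (p q x3 y3 : R) : cross e1 e2 != 0 ->
  0 < p < 1 -> 0 < q < 1 -> x3 = p - p * y3 -> y3 = q - q * x3 ->
  let P := pt O e1 e2 in
  let v := Vertices (P 0 0) (P 0 q) (P x3 y3) (P p 0) (P 1 0) (P 0 1) in
  (forall i, 0 < a v i) /\ [/\ b v i1 = (1 - p) / p, b v i2 = (1 - q) / q,
    b v i3 = (1 - x3) / x3 & b v i4 = (1 - y3) / y3].
Proof.
move=> De p01 q01 x3E y3E P v.
have [x30 x3p y30 y3q] := p34_bounds p01 q01 x3E y3E.
have x301 : 0 < x3 < 1 by move: p01; lra.
have y301 : 0 < y3 < 1 by move: q01; lra.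
have Pneq a0 b0 c0 d0 : (a0 != c0) || (b0 != d0) -> P a0 b0 != P c0 d0.
  by apply: contraTneq => /(pt_inj De)[-> ->]; rewrite !eqxx.
have h1 : P 0 0 != P 1 0 by apply: Pneq; rewrite eq_sym oner_eq0.
have h2 : P 0 0 != P 0 1 by apply: Pneq; rewrite (eq_sym _ 1) oner_eq0 orbT.
have h3 : P 0 q != P 1 0 by apply: Pneq; rewrite eq_sym oner_eq0.
have h4 : P p 0 != P 0 1 by apply: Pneq; rewrite (eq_sym _ 1) oner_eq0 orbT.
have [] := dist_ratio h1 p01; have [] := dist_ratio h2 q01.
have [] := dist_ratio h3 x301; have [] := dist_ratio h4 y301.
rewrite /P !pt_line !(sub0r, subr0, oppr0, mulr0, addr0, add0r, mulr1, mulrN) -/P.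
(* The point of parameter [x3] on the third line has ordinate [q - q * x3], which is [y3]; the
   fourth line is similar. Both points are thus [P34]. *)
rewrite (mulrC y3) (mulrC x3) -x3E -y3E => a4 b4 a3 b3 a2 b2 a1 b1.
split.
  by apply: forall_I4; rewrite /a /len /sideA /tnth/= // distC.
by split; rewrite /b /a /len /sideA /sideB /tnth/= -?b1 -?b2 -?b3 -?b4 //;
  [rewrite (distC _ (P 0 0))|rewrite (distC _ (P p 0))].
Qed.

(** Menelaus' theorem twice: for the triangle [P12], [P23], [X] cut by the fourth line, and for the
    triangle [P12], [P41], [Y] cut by the third. *)
Definition menelaus (c1 c2 c3 c4 : R) :=
  c2 * c3 = c1 * (c2 + 1) /\ c1 * c4 = (c1 + 1) * c2.

Lemma menelaus_frame (p q x3 y3 : R) : 0 < p < 1 -> 0 < q < 1 ->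
  x3 = p - p * y3 -> y3 = q - q * x3 ->
  menelaus ((1 - p) / p) ((1 - q) / q) ((1 - x3) / x3) ((1 - y3) / y3).
Proof.
move=> p01 q01 x3E y3E.
have [x30 x3p y30 y3q] := p34_bounds p01 q01 x3E y3E.
have [p0 _] := andP p01; have [q0 _] := andP q01.
have hx : x3 = p - p * (q - q * x3) by rewrite -y3E.
have hy : y3 = q - q * (p - p * y3) by rewrite -x3E.
split.
  apply: (@mulfI _ (p * q * x3)); first by rewrite !mulf_neq0 ?gt_eqF.
  have -> : p * q * x3 * ((1 - q) / q * ((1 - x3) / x3)) = p * (1 - q) * (1 - x3).
    by field; rewrite !gt_eqF.
  have -> : p * q * x3 * ((1 - p) / p * ((1 - q) / q + 1)) = (1 - p) * x3.
    by field; rewrite !gt_eqF.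
  (* With denominators cleared, this is [x3 * (1 - p * q) = p * (1 - q)], that is [hx]. *)
  lra.
apply: (@mulfI _ (p * q * y3)); first by rewrite !mulf_neq0 ?gt_eqF.
have -> : p * q * y3 * ((1 - p) / p * ((1 - y3) / y3)) = q * (1 - p) * (1 - y3).
  by field; rewrite !gt_eqF.
have -> : p * q * y3 * (((1 - p) / p + 1) * ((1 - q) / q)) = (1 - q) * y3.
  by field; rewrite !gt_eqF.
lra.
Qed.

(* Of three collinear points one lies between the two others, hence on all three
   segments. *)
Lemma triangle_nondegenerate T i j k z w v : configuration T ->
  i != j -> j != k -> i != k ->
  seg (T i) z -> seg (T j) z -> seg (T i) w -> seg (T k) w ->
  seg (T j) v -> seg (T k) v -> cross (w - z) (v - z) != 0.
Proof.
move=> [_ /(_ i j k) h] ij jk ik iz jz iw kw jv kv.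
have {h} no x : seg (T i) x -> seg (T j) x -> seg (T k) x -> False.
  move=> ix jx kx; have := h ij jk ik; rewrite -subset0 => /(_ x); apply.
  by [].
apply/eqP => cr.
have wz : w - z != 0.
  by rewrite subr_eq0; apply/eqP => wz; apply: (no z) => //; rewrite -wz.
have [r vE] : exists r, v = z + r *: (w - z).
  have [w0|w1] : (w - z) 0 0 != 0 \/ (w - z) 0 1 != 0.
    have [w0|] := eqVneq ((w - z) 0 0) 0; last by left.
    right; apply: contraNneq wz => w1.
    by apply/eqP/rV2P; rewrite ?w0 ?w1 mxE.
  - exists ((v - z) 0 0 / (w - z) 0 0); move: cr w0; rewrite /cross !mxE => cr w0.
    apply: rV2P; rewrite !mxE; first by field.
    by apply: (mulIf w0); rewrite mulrDl (mulrAC (v 0 0 - z 0 0)) divfK//; lra.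
  - exists ((v - z) 0 1 / (w - z) 0 1); move: cr w1; rewrite /cross !mxE => cr w1.
    apply: rV2P; rewrite !mxE; last by field.
    by apply: (mulIf w1); rewrite mulrDl (mulrAC (v 0 1 - z 0 1)) divfK//; lra.
have [r0|r0] := ltP r 0.
  apply: (no z) => //; have -> : z = w + (1 - r)^-1 *: (v - w).
    by rewrite vE; apply: rV2P; rewrite !mxE; field; lra.
  apply: seg_convex => //; rewrite -(mul1r (_^-1)); apply: div01; lra.
have [r1|r1] := ltP 1 r.
  apply: (no w) => //; have -> : w = z + r^-1 *: (v - z).
    by rewrite vE; apply: rV2P; rewrite !mxE; field; lra.
  apply: seg_convex => //; rewrite -(mul1r (_^-1)); apply: div01; lra.
apply: (no v) => //; rewrite vE; apply: seg_convex => //; exact/andP.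
Qed.

Lemma labeling_frame T (L : vertices R) : configuration T -> labeling T L ->
  exists O e1 e2 (p q x3 y3 : R), let P := pt O e1 e2 in
    [/\ cross e1 e2 != 0, 0 < p < 1 /\ 0 < q < 1,
        x3 = p - p * y3, y3 = q - q * x3 &
        L = Vertices (P 0 0) (P 0 q) (P x3 y3) (P p 0) (P 1 0) (P 0 1)].
Proof.
case: L => P12 P23 P34 P41 X Y cT [/= m12 m23 m34 m41 m13 m24].
move=> [_ [p p01 p41E]] [_ [x3 _ p34E]] [_ [q q01 p23E]] [_ [y3 _ p34E']].
pose P := pt P12 (X - P12) (Y - P12).
exists P12, (X - P12), (Y - P12), p, q, x3, y3.
have [s12 s12'] : (seg (T i1) `&` seg (T i2)) P12 by rewrite m12.
have [s23 s23'] : (seg (T i2) `&` seg (T i3)) P23 by rewrite m23.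
have [s13 s13'] : (seg (T i1) `&` seg (T i3)) X by rewrite m13.
(* Since [P23 - P12] is [q] times [Y - P12], nondegeneracy of the triangle [P12], [X], [P23] yields
   that of the frame. *)
have := triangle_nondegenerate cT _ _ _ s12 s12' s13 s13' s23 s23'.
move=> /(_ isT isT isT) ncr.
have De : cross (X - P12) (Y - P12) != 0.
  apply: contraNneq ncr => cr.
  have -> : cross (X - P12) (P23 - P12) = q * cross (X - P12) (Y - P12).
    by rewrite p23E /cross !mxE; ring.
  by rewrite cr mulr0.
(* [P34] is located once on the third line and once on the fourth; comparing coordinates gives the
   equations for [x3] and [y3]. *)
have E34 : P34 = P x3 (q - q * x3).
  by rewrite p34E p23E; apply: rV2P; rewrite !mxE; ring.
have E34' : P34 = P (p - p * y3) y3.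
  by rewrite p34E' p41E; apply: rV2P; rewrite !mxE; ring.
have := E34; rewrite E34' => /(pt_inj De)[hx hy].
split=> //; congr Vertices.
- by apply: rV2P; rewrite !mxE; ring.
- by rewrite p23E; apply: rV2P; rewrite !mxE; ring.
- by rewrite hx.
- by rewrite p41E; apply: rV2P; rewrite !mxE; ring.
- by apply: rV2P; rewrite !mxE; ring.
- by apply: rV2P; rewrite !mxE; ring.
Qed.

(** * Existence of a labelling *)

Lemma mulr_sub_lt0 (x y t : R) : x != t -> y != t ->
  ((x - t) * (y - t) < 0) = (x < t) (+) (y < t).
Proof.
case: (ltgtP x t) => // xt _; case: (ltgtP y t) => // yt _.
- by rewrite nmulr_rlt0 ?subr_lt0// subr_gt0 lt_gtF.
- by rewrite nmulr_rlt0 ?subr_lt0// subr_gt0 yt.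
- by rewrite pmulr_rlt0 ?subr_gt0// subr_lt0 yt.
- by rewrite pmulr_rlt0 ?subr_gt0// subr_lt0 lt_gtF.
Qed.

Lemma mem_uniq4 (s : seq 'I_4) : uniq s -> size s = 4 -> forall x, x \in s.
Proof.
move=> us s4 x; have sub : {subset s <= enum 'I_4} by move=> y _; rewrite mem_enum.
by have [|_ ->] := uniq_min_size us sub; rewrite ?mem_enum// size_enum_ord s4.
Qed.

Section Existence.
Variable T : 'I_4 -> 'rV[R]_2 * 'rV[R]_2.
Hypothesis cT : configuration T.

(** A chosen common point; [crossing_unique] shows later that there is no other when [i != j]. *)
Let P i j : 'rV[R]_2 := get (seg (T i) `&` seg (T j)).

Lemma crossing_sym i j : P i j = P j i.
Proof. by rewrite /P setIC. Qed.

Lemma crossing_in i j : seg (T i) (P i j) /\ seg (T j) (P i j).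
Proof. by have [+ _] := cT => /(_ i j)/getPex. Qed.

Lemma crossing_inl i j : seg (T i) (P i j).
Proof. by have [] := crossing_in i j. Qed.

Lemma crossing_inr i j : seg (T j) (P i j).
Proof. by have [] := crossing_in i j. Qed.

Lemma crossing_inj i j k : i != j -> j != k -> i != k -> P i j != P i k.
Proof.
move=> ij jk ik; apply/eqP => E; have [_ /(_ i j k ij jk ik)] := cT.
rewrite -subset0 => /(_ (P i j)); apply; split; first exact: crossing_in.
by rewrite E; exact: crossing_inr.
Qed.

(** An affine form vanishing on the line of [T l], whose sign tells the side. It would be
    identically zero if the endpoints coincided, hence [crossing_endpoints]. *)
Let f l z := cross ((T l).2 - (T l).1) (z - (T l).1).

Lemma supporting_form_affine l : affine (f l).
Proof. by move=> z w t; rewrite /f /cross !mxE; ring. Qed.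

Lemma supporting_form_seg l z : seg (T l) z -> f l z = 0.
Proof. by move=> /segE[t _ ->]; rewrite /f /cross !mxE; ring. Qed.

(** Multiplied by a nonzero coordinate of the direction [B - A], the determinant becomes a
    combination of differences of values of the form. *)
Lemma supporting_form_collinear l z w v : (T l).1 != (T l).2 ->
  f l z = 0 -> f l w = 0 -> f l v = 0 -> cross (w - z) (v - z) = 0.
Proof.
rewrite /f; set A := (T l).1; set B := (T l).2 => AB.
have [|] : (B - A) 0 0 != 0 \/ (B - A) 0 1 != 0.
  have [d0|] := eqVneq ((B - A) 0 0) 0; last by left.
  right; apply: contraNneq AB => d1; rewrite eq_sym -subr_eq0.
  by apply/eqP/rV2P; rewrite ?d0 ?d1 mxE.
- rewrite /cross !mxE => d0 hz hw hv; apply: (mulfI d0); rewrite mulr0.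
  set d := B 0 0 - A 0 0; set e := B 0 1 - A 0 1.
  have -> : d * ((w 0 0 - z 0 0) * (v 0 1 - z 0 1)
                 - (w 0 1 - z 0 1) * (v 0 0 - z 0 0))
   = (w 0 0 - z 0 0) * ((d * (v 0 1 - A 0 1) - e * (v 0 0 - A 0 0)) -
       (d * (z 0 1 - A 0 1) - e * (z 0 0 - A 0 0)))
   - (v 0 0 - z 0 0) * ((d * (w 0 1 - A 0 1) - e * (w 0 0 - A 0 0)) -
       (d * (z 0 1 - A 0 1) - e * (z 0 0 - A 0 0))) by ring.
  by rewrite hz hw hv; ring.
- rewrite /cross !mxE => d0 hz hw hv; apply: (mulfI d0); rewrite mulr0.
  set d := B 0 0 - A 0 0; set e := B 0 1 - A 0 1.
  have -> : e * ((w 0 0 - z 0 0) * (v 0 1 - z 0 1)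
                 - (w 0 1 - z 0 1) * (v 0 0 - z 0 0))
   = (w 0 1 - z 0 1) * ((d * (v 0 1 - A 0 1) - e * (v 0 0 - A 0 0)) -
       (d * (z 0 1 - A 0 1) - e * (z 0 0 - A 0 0)))
   - (v 0 1 - z 0 1) * ((d * (w 0 1 - A 0 1) - e * (w 0 0 - A 0 0)) -
       (d * (z 0 1 - A 0 1) - e * (z 0 0 - A 0 0))) by ring.
  by rewrite hz hw hv; ring.
Qed.

Lemma crossing_endpoints i j k : i != j -> j != k -> i != k -> (T i).1 != (T i).2.
Proof.
move=> ij jk ik; apply: contraNneq (crossing_inj ij jk ik) => E.
have seg_triv z : seg (T i) z -> z = (T i).1.
  by move=> /segE[t _ ->]; rewrite -E subrr scaler0 addr0.
by apply/eqP; rewrite (seg_triv _ (crossing_inl i j)) (seg_triv _ (crossing_inl i k)).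
Qed.

Lemma supporting_form_neq0 i j k : i != j -> j != k -> i != k -> f i (P j k) != 0.
Proof.
move=> ij jk ik; apply/eqP => E.
have := triangle_nondegenerate cT ij jk ik (crossing_inl i j) (crossing_inr i j)
  (crossing_inl i k) (crossing_inr i k) (crossing_inl j k) (crossing_inr j k).
rewrite (supporting_form_collinear (crossing_endpoints ij jk ik)) ?eqxx//;
  by apply: supporting_form_seg; exact: crossing_inl.
Qed.

(** A second common point would put all of [T j] on the line of [T i], including its crossing with a
    third segment. *)
Lemma crossing_unique i j : i != j -> seg (T i) `&` seg (T j) = [set P i j].
Proof.
move=> ij; apply/seteqP; split=> [z [iz jz]|_ ->]; last exact: crossing_in.
have [k [ik jk]] : exists k, i != k /\ j != k.
  have /card_gt0P[k] : (0 < #|[set~ i] :\ j|)%N.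
    have := cardsD1 j [set~ i]; rewrite cardsC1 card_ord !inE eq_sym ij.
    by case: #|_|.
  by rewrite !inE => /andP[jk ik]; exists k; rewrite !(eq_sym _ k).
apply/eqP; apply: contraTT (supporting_form_neq0 ij jk ik) => zP; rewrite negbK.
apply/eqP; apply: (seg_affine0 (@supporting_form_affine i) jz (crossing_inr i j) zP).
- exact: supporting_form_seg.
- exact/supporting_form_seg/crossing_inl.
- exact: crossing_inl.
Qed.

Lemma crossing_between i k j l : uniq [:: i; k; j; l] ->
  f k (P i j) * f k (P i l) < 0 -> between (P i j) (P i k) (P i l).
Proof.
rewrite /= !inE !negb_or => /and4P[/and3P[ik ij il] /andP[kj kl] jl _] fjl.
have jl' : P i j != P i l by exact: crossing_inj.
split=> //.
have fk0 := supporting_form_seg (crossing_inr i k).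
have /segE[c _ lE] := crossing_inl i l.
have /segE[d _ jE] := crossing_inl i j.
have /segE[e _ kE] := crossing_inl i k.
have cd : c - d != 0.
  by apply: contraNneq jl' => /subr0_eq cd; rewrite lE jE cd.
set t := (e - d) / (c - d).
have E : P i k = P i j + t *: (P i l - P i j).
  by rewrite lE jE kE /t; apply: rV2P; rewrite !mxE; field.
exists t; last by rewrite E; apply: rV2P; rewrite !mxE; ring.
move: fjl fk0; rewrite E (supporting_form_affine k); move: (f k _) (f k _) => y x xy fk.
have x0 : 0 < x ^+ 2.
  have : x != 0 by apply: contraTneq xy => ->; rewrite mul0r ltxx.
  by rewrite lt0r sqr_ge0 sqrf_eq0 => ->.
(* Multiplying the equation for [t] by [x] makes its coefficient positive whatever the sign of [x];
   the coefficient also exceeds [x ^+ 2], so [t] lies strictly between 0 and 1. *)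
have xxy : 0 < x ^+ 2 - x * y by lra.
have tE : t * (x ^+ 2 - x * y) = x ^+ 2 by move: (congr1 ( *%R x) fk); lra.
apply/andP; split; first by rewrite -(pmulr_lgt0 _ xxy) tE.
by rewrite -subr_gt0 -(pmulr_lgt0 _ xxy) mulrBl tE; lra.
Qed.

(** The crossing with [T k] is the middle one on [T i]: the other two are on opposite sides of the
    line of [T k]. Quantifying over [j] and [l] makes this a relation between [i] and [k] alone. *)
Definition middle i k := [forall j, forall l,
  uniq [:: i; k; j; l] ==> (f k (P i j) * f k (P i l) < 0)].

Lemma middleE i k j l : uniq [:: i; k; j; l] ->
  middle i k = (f k (P i j) * f k (P i l) < 0).
Proof.
move=> u; apply/idP/idP => [/forallP/(_ j)/forallP/(_ l)/implyP/(_ u)//|jl].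
have all4 := mem_uniq4 u erefl.
apply/forallP => j'; apply/forallP => l'; apply/implyP.
move: u; rewrite /= !inE !negb_or => _.
have := all4 j'; have := all4 l'; rewrite !inE => lI jI.
move=> /and4P[/and3P[_ ij' il'] /andP[kj' kl'] jl' _].
rewrite (eq_sym i) in ij'; rewrite (eq_sym i) in il'.
rewrite (eq_sym k) in kj'; rewrite (eq_sym k) in kl'.
rewrite (negbTE ij') (negbTE kj')/= in jI; rewrite (negbTE il') (negbTE kl')/= in lI.
case/orP: jI jl' => /eqP->; case/orP: lI => /eqP->; rewrite ?eqxx// => _.
by rewrite mulrC.
Qed.

(** The three crossings have distinct parameters on [T i], and exactly one of three distinct reals
    lies between the others. *)
Lemma middle_row i j k l : uniq [:: i; j; k; l] ->
  [/\ [|| middle i j, middle i k | middle i l], ~~ (middle i j && middle i k),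
      ~~ (middle i j && middle i l) & ~~ (middle i k && middle i l)].
Proof.
move=> u; have uk : uniq [:: i; k; j; l].
  (* Equality up to order amounts to equality of counts, which are sums of natural numbers, hence
     [ring]. *)
  by rewrite -(perm_uniq (s1 := [:: i; j; k; l]))//; apply/seq.permP => a /=; ring.
have ul : uniq [:: i; l; j; k].
  by rewrite -(perm_uniq (s1 := [:: i; j; k; l]))//; apply/seq.permP => a /=; ring.
rewrite (middleE u) (middleE uk) (middleE ul).
move: u; rewrite /= !inE !negb_or => /and4P[/and3P[ij ik il] /andP[jk jl] kl _].
have /segE[c _ jE] := crossing_inl i j; have /segE[d _ kE] := crossing_inl i k.
have /segE[e _ lE] := crossing_inl i l.
have fE h x y (z w : 'rV[R]_2) : z = (T i).1 + x *: ((T i).2 - (T i).1) ->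
    w = (T i).1 + y *: ((T i).2 - (T i).1) -> f h w = 0 ->
    f h z = (x - y) * (f h (T i).2 - f h (T i).1).
  by move=> -> ->; rewrite !(supporting_form_affine h); lra.
have side h x y t (z v w : 'rV[R]_2) : z = (T i).1 + x *: ((T i).2 - (T i).1) ->
    v = (T i).1 + y *: ((T i).2 - (T i).1) ->
    w = (T i).1 + t *: ((T i).2 - (T i).1) -> f h w = 0 ->
    f h z != 0 -> f h v != 0 ->
    (f h z * f h v < 0) = (x < t) (+) (y < t) /\ x != t /\ y != t.
  move=> zE vE wE fw; rewrite (fE h x t z w zE wE fw) (fE h y t v w vE wE fw).
  set m := f h _ - _; rewrite !mulf_eq0 !negb_or => /andP[xt m0] /andP[yt _].
  rewrite !subr_eq0 in xt yt; rewrite mulrACA pmulr_llt0; last first.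
    by rewrite lt0r mulf_neq0//= -expr2 sqr_ge0.
  by rewrite mulr_sub_lt0.
have [||-> [dc ec]] := side j d e c _ _ _ kE lE jE (supporting_form_seg (crossing_inr i j)).
- by rewrite supporting_form_neq0// eq_sym.
- by rewrite supporting_form_neq0// eq_sym.
have [||-> [cd ed]] := side k c e d _ _ _ jE lE kE (supporting_form_seg (crossing_inr i k)).
- by rewrite supporting_form_neq0// eq_sym.
- by rewrite supporting_form_neq0// eq_sym.
have [||-> _] := side l c d e _ _ _ jE kE lE (supporting_form_seg (crossing_inr i l)).
- by rewrite supporting_form_neq0// eq_sym.
- by rewrite supporting_form_neq0// eq_sym.
move: dc ec ed; case: (ltgtP c d) => // h1; case: (ltgtP c e) => // h2;
  case: (ltgtP d e) => // h3 _ _ _.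
- by have := lt_trans h1 h3; rewrite ltNge ltW.
- by have := lt_trans h3 h1; rewrite ltNge ltW.
Qed.

(* Pasch: the product of the three pairwise products of the values of [f l] at
   the vertices of the triangle is a square. *)
Lemma middle_column i j k l : uniq [:: i; j; k; l] ->
  middle i l (+) middle j l (+) middle k l = false.
Proof.
move=> u; have ui : uniq [:: i; l; j; k].
  by rewrite -(perm_uniq (s1 := [:: i; j; k; l]))//; apply/seq.permP => a /=; ring.
have uj : uniq [:: j; l; i; k].
  by rewrite -(perm_uniq (s1 := [:: i; j; k; l]))//; apply/seq.permP => a /=; ring.
have uk : uniq [:: k; l; i; j].
  by rewrite -(perm_uniq (s1 := [:: i; j; k; l]))//; apply/seq.permP => a /=; ring.
rewrite (middleE ui) (middleE uj) (middleE uk).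
rewrite (crossing_sym j i) (crossing_sym k i) (crossing_sym k j).
move: u; rewrite /= !inE !negb_or => /and4P[/and3P[ij ik il] /andP[jk jl] kl _].
have : f l (P i j) != 0 by rewrite supporting_form_neq0// eq_sym.
have : f l (P i k) != 0 by rewrite supporting_form_neq0// eq_sym.
have : f l (P j k) != 0 by rewrite supporting_form_neq0// eq_sym.
move: (f l _) (f l _) (f l _) => x y z.
rewrite !neq_lt => /orP[] x0 /orP[] y0 /orP[] z0.
all: rewrite ?(nmulr_rlt0 _ x0) ?(pmulr_rlt0 _ x0) ?(nmulr_rlt0 _ y0)
  ?(pmulr_rlt0 _ y0) ?(nmulr_rlt0 _ z0) ?(pmulr_rlt0 _ z0).
all: by rewrite ?x0 ?y0 ?z0 ?(lt_gtF x0) ?(lt_gtF y0) ?(lt_gtF z0).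
Qed.

(** Four marks, one per row, with zero or two in each column, fill two columns [k] and [l]. Rows [k]
    and [l] mark each other since the diagonal is excluded, and the other two rows mark one column
    each. This leaves twelve matrices. *)
Lemma labels_of_middle (M : 'I_4 -> 'I_4 -> bool) :
  (forall i j k l, uniq [:: i; j; k; l] ->
    [/\ [|| M i j, M i k | M i l], ~~ (M i j && M i k),
        ~~ (M i j && M i l) & ~~ (M i k && M i l)]) ->
  (forall i j k l, uniq [:: i; j; k; l] -> M i l (+) M j l (+) M k l = false) ->
  exists i j k l, uniq [:: i; j; k; l] /\ [/\ M i l, M k l, M j k & M l k].
Proof.
move=> row col.
have onehot i j k l : uniq [:: i; j; k; l] ->
  [\/ (M i j = true) * (M i k = false) * (M i l = false),
      (M i j = false) * (M i k = true) * (M i l = false) |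
      (M i j = false) * (M i k = false) * (M i l = true)].
  move=> /row[]; case: (M i j); case: (M i k); case: (M i l) => //= _ _ _ _;
  by [constructor 1|constructor 2|constructor 3].
have c4 := col i1 i2 i3 i4 isT; have c3 := col i1 i2 i4 i3 isT.
have c2 := col i1 i3 i4 i2 isT; have c1 := col i2 i3 i4 i1 isT.
have [] := onehot i1 i2 i3 i4 isT => E1; have [] := onehot i2 i1 i3 i4 isT => E2;
have [] := onehot i3 i1 i2 i4 isT => E3; rewrite !E1 !E2 ?E3 in c1 c2 c3 c4;
have [] := onehot i4 i1 i2 i3 isT => E4; rewrite ?E3 ?E4 // in c1 c2 c3 c4;
clear c1 c2 c3 c4; first
  [by exists i1, i2, i3, i4; rewrite ?E1 ?E2 ?E3 ?E4
  |by exists i2, i1, i3, i4; rewrite ?E1 ?E2 ?E3 ?E4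
  |by exists i1, i3, i2, i4; rewrite ?E1 ?E2 ?E3 ?E4
  |by exists i3, i1, i2, i4; rewrite ?E1 ?E2 ?E3 ?E4
  |by exists i1, i4, i2, i3; rewrite ?E1 ?E2 ?E3 ?E4
  |by exists i4, i1, i2, i3; rewrite ?E1 ?E2 ?E3 ?E4
  |by exists i2, i3, i1, i4; rewrite ?E1 ?E2 ?E3 ?E4
  |by exists i3, i2, i1, i4; rewrite ?E1 ?E2 ?E3 ?E4
  |by exists i2, i4, i1, i3; rewrite ?E1 ?E2 ?E3 ?E4
  |by exists i4, i2, i1, i3; rewrite ?E1 ?E2 ?E3 ?E4
  |by exists i3, i4, i1, i2; rewrite ?E1 ?E2 ?E3 ?E4
  |by exists i4, i3, i1, i2; rewrite ?E1 ?E2 ?E3 ?E4].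
Qed.

Lemma labeling_exists : exists (s : {perm 'I_4}) (v : vertices R),
  labeling (fun i => T (s i)) v.
Proof.
have [A [B [C [D [u [mAD mCD mBC mDC]]]]]] := labels_of_middle middle_row middle_column.
pose t := [tuple A; B; C; D].
have inj_t : injective (tnth t) by apply/tuple_uniqP.
exists (perm inj_t), (Vertices (P A B) (P B C) (P C D) (P D A) (P A C) (P B D)).
have [sA sB sC sD] : [/\ perm inj_t i1 = A, perm inj_t i2 = B,
    perm inj_t i3 = C & perm inj_t i4 = D] by split; rewrite permE.
have btw i k j l : middle i k -> perm_eq [:: A; B; C; D] [:: i; k; j; l] ->
    between (P i j) (P i k) (P i l).
  move=> + /perm_uniq; rewrite u => + /esym ul.
  by rewrite (middleE ul); exact: crossing_between.
have /= := u; rewrite !inE !negb_or => /and4P[/and3P[AB AC AD] /andP[BC BD] CD _].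
split; rewrite /= ?sA ?sB ?sC ?sD; try by apply: crossing_unique.
- by apply: crossing_unique; rewrite eq_sym.
- rewrite (crossing_sym D A); apply: btw mAD _; apply/seq.permP => h /=; ring.
- rewrite (crossing_sym B C) (crossing_sym A C).
  by apply: btw mCD _; apply/seq.permP => h /=; ring.
- rewrite (crossing_sym A B); apply: btw mBC _; apply/seq.permP => h /=; ring.
- rewrite (crossing_sym C D) (crossing_sym B D).
  by apply: btw mDC _; apply/seq.permP => h /=; ring.
Qed.

End Existence.

(** * The relations and their rational solutions *)

Lemma configuration_perm (S : 'I_4 -> 'rV[R]_2 * 'rV[R]_2) (s : {perm 'I_4}) :
  configuration S -> configuration (fun i => S (s i)).
Proof.
by move=> [meet triple]; split=> [i j|i j k ij jk ik]; [exact: meet|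
  apply: triple; rewrite (inj_eq perm_inj)].
Qed.

Lemma bounded_faces_perm (S : 'I_4 -> 'rV[R]_2 * 'rV[R]_2) (s : {perm 'I_4}) :
  bounded_faces (fun i => S (s i)) = bounded_faces S.
Proof.
rewrite /bounded_faces.
suff -> : \bigcup_i seg (S (s i)) = \bigcup_i seg (S i) by [].
apply/seteqP; split=> z [i _ iz]; first by exists (s i).
by exists (s^-1%g i) => //; rewrite permKV.
Qed.

Lemma labeling_ratios T (v : vertices R) : configuration T -> labeling T v ->
  (forall i, 0 < a v i /\ 0 < b v i) /\
  menelaus (b v i1) (b v i2) (b v i3) (b v i4).
Proof.
move=> cT /(labeling_frame cT).
move=> [Z [e1 [e2 [p [q [x3 [y3 [De [p01 q01] x3E y3E vE]]]]]]]]; rewrite vE.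
have [a0 [b1 b2 b3 b4]] := ratios_frame Z De p01 q01 x3E y3E.
have [x30 x3p y30 y3q] := p34_bounds p01 q01 x3E y3E.
split; last by rewrite b1 b2 b3 b4; exact: menelaus_frame.
have [p0 p1] := andP p01; have [q0 q1] := andP q01.
move=> i; split; first exact: a0.
move: i; apply: forall_I4.
- by rewrite b1 divr_gt0// subr_gt0.
- by rewrite b2 divr_gt0// subr_gt0.
- by rewrite b3 divr_gt0// subr_gt0; lra.
- by rewrite b4 divr_gt0// subr_gt0; lra.
Qed.

Lemma labeling_faces T (v : vertices R) : configuration T -> labeling T v ->
  bound_quad_and_triangles T v.
Proof.
move=> cT lT; have := labeling_frame cT lT.
move=> [Z [e1 [e2 [p [q [x3 [y3 [De [p01 q01] x3E y3E vE]]]]]]]].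
have : forall i, seg (T i) (endA Z e1 e2 p q i) /\ seg (T i) (endB Z e1 e2 i).
  move: lT; rewrite vE => -[/= m12 m23 m34 m41 m13 m24 _ _ _ _].
  have cap i j z : seg (T i) `&` seg (T j) = [set z] -> seg (T i) z /\ seg (T j) z.
    by move=> E; have : (seg (T i) `&` seg (T j)) z by rewrite E.
  by apply: forall_I4; split; [have [] := cap _ _ _ m12|have [] := cap _ _ _ m13|
    have [] := cap _ _ _ m12|have [] := cap _ _ _ m24|have [] := cap _ _ _ m23|
    have [] := cap _ _ _ m13|have [] := cap _ _ _ m41|have [] := cap _ _ _ m24].
move=> h; rewrite vE; apply: bound_quad_and_triangles_frame => // i;
  by have [] := h i.
Qed.

(** Formulas that lead from any two of the ratios to the others; positivity keeps every denominator
    nonzero. *)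
Lemma menelaus_pairs (c1 c2 c3 c4 : R) : menelaus c1 c2 c3 c4 ->
  0 < c1 -> 0 < c2 -> 0 < c3 -> 0 < c4 ->
  [/\ c3 = c1 * (c2 + 1) / c2, c4 = (c1 + 1) * c2 / c1, c2 = c1 / (c3 - c1),
      c2 = c1 * c4 / (c1 + 1) & c1 = c2 * c3 / (c2 + 1)] /\
  c1 = c2 / (c4 - c2) /\ c1 = (c3 * c4 - 1) / (c4 + 1).
Proof.
move=> [E1 E2] h1 h2 h3 h4.
have n31 : c3 - c1 != 0.
  by apply/eqP => /subr0_eq E; move: E1; rewrite E; lra.
have n42 : c4 - c2 != 0.
  by apply/eqP => /subr0_eq E; move: E2; rewrite E; lra.
have E3 : c2 * (c3 - c1) = c1 by lra.
have E4 : c1 * (c4 - c2) = c2 by lra.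
split; [split|split].
- by rewrite -E1 mulrAC divff ?gt_eqF// mul1r.
- by rewrite -E2 mulrAC divff ?gt_eqF// mul1r.
- by rewrite -[LHS](mulfK n31) E3.
- by rewrite E2 mulrAC divff ?mul1r// gt_eqF// addr_gt0.
- by rewrite E1 mulfK// gt_eqF// addr_gt0.
- by rewrite -[LHS](mulfK n42) E4.
- have n4 : c4 + 1 != 0 by rewrite gt_eqF// addr_gt0.
  (* After multiplication by [c2], both sides reduce to [c2 * ((c1 + 1) * c2 + c1)]. *)
  apply: (mulIf n4); rewrite divfK//; apply: (mulIf (lt0r_neq0 h2)).
  have -> : (c3 * c4 - 1) * c2 = c2 * c3 * c4 - c2 by ring.
  rewrite E1; have -> : c1 * (c2 + 1) * c4 = c1 * c4 * (c2 + 1) by ring.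
  rewrite E2; have -> : c1 * (c4 + 1) * c2 = (c1 * c4 + c1) * c2 by ring.
  by rewrite E2; ring.
Qed.

(** The rationals are fixed before [c], so rationality and uniqueness come together. For values
    [qi], [qj] that no [c] attains, a zero denominator is harmless, as the claim is vacuous. *)
Lemma rational_ratios (i j : 'I_4) (qi qj : rat) : i != j ->
  exists r1 r2 : rat, forall c : 'I_4 -> R, (forall k, 0 < c k) ->
    menelaus (c i1) (c i2) (c i3) (c i4) ->
    c i = ratr qi -> c j = ratr qj -> c i1 = ratr r1 /\ c i2 = ratr r2.
Proof.
move=> ij.
pose s13 (r1 r3 : rat) := r1 / (r3 - r1).
pose s14 (r1 r4 : rat) := r1 * r4 / (r1 + 1).
pose s23 (r2 r3 : rat) := r2 * r3 / (r2 + 1).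
pose s24 (r2 r4 : rat) := r2 / (r4 - r2).
pose s34 (r3 r4 : rat) := (r3 * r4 - 1) / (r4 + 1).
(* One witness for each ordered pair of distinct indices. From the third and fourth ratios, [s34]
   gives the first, and [s14] then the second. *)
move: i j ij; apply: forall_I4; apply: forall_I4 => // _;
 [exists qi, qj|exists qi, (s13 qi qj)|exists qi, (s14 qi qj)
 |exists qj, qi|exists (s23 qi qj), qi|exists (s24 qi qj), qi
 |exists qj, (s13 qj qi)|exists (s23 qj qi), qj
 |exists (s34 qi qj), (s14 (s34 qi qj) qj)
 |exists qj, (s14 qj qi)|exists (s24 qj qi), qj
 |exists (s34 qj qi), (s14 (s34 qj qi) qi)];
 move=> c c0 m ci cj;
 have [[e3 e4 e13 e14 e23] [e24 e34]] := menelaus_pairs m (c0 _) (c0 _) (c0 _) (c0 _);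
 split=> //; rewrite /s14 /s13 /s23 /s24 /s34 !(fmorph_div, rmorphM, rmorphB, rmorphD, rmorph1);
 rewrite /= -?ci -?cj -?e34 //.
Qed.

End Plane.

Theorem lemma4p5 (R : realType) :
  (forall S : 'I_4 -> 'rV[R]_2 * 'rV[R]_2, configuration S ->
     (exists (s : {perm 'I_4}) (v : vertices R), labeling (fun i => S (s i)) v)
     /\
     (forall (s : {perm 'I_4}) (v : vertices R),
        labeling (fun i => S (s i)) v ->
        [/\ bound_quad_and_triangles S v,
            forall i, 0 < a v i /\ 0 < b v i,
            b v i2 * b v i3 = b v i1 * (b v i2 + 1) &
            b v i1 * b v i4 = (b v i1 + 1) * b v i2]))
  /\
  (forall (i j : 'I_4) (qi qj : rat), i != j ->
     exists c : 'I_4 -> rat,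
       forall (S : 'I_4 -> 'rV[R]_2 * 'rV[R]_2) (s : {perm 'I_4})
              (v : vertices R),
         configuration S -> labeling (fun k => S (s k)) v ->
         b v i = ratr qi -> b v j = ratr qj ->
         forall k, b v k = ratr (c k)).
Proof.
split=> [S cS|i j qi qj ij].
  split; first exact: labeling_exists.
  move=> s v lv; have cSs := configuration_perm s cS.
  have [pos [E1 E2]] := labeling_ratios cSs lv; split=> //.
  have := labeling_faces cSs lv.
  by rewrite /bound_quad_and_triangles bounded_faces_perm.
have [r1 [r2 r12]] := rational_ratios R qi qj ij.
exists (fun k => match val k with
  | 0 => r1 | 1 => r2 | 2 => r1 * (r2 + 1) / r2 | _ => (r1 + 1) * r2 / r1 end).
move=> S s v /(configuration_perm s) cSs lv bi bj.
have [pos m] := labeling_ratios cSs lv.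
have pos' k : 0 < b v k by have [] := pos k.
have [b1 b2] := r12 (b v) pos' m bi bj.
have [[b3 b4 _ _ _] _] := menelaus_pairs m (pos' _) (pos' _) (pos' _) (pos' _).
apply: forall_I4 => //=.
  by rewrite b3 b1 b2 fmorph_div rmorphM rmorphD rmorph1.
by rewrite b4 b1 b2 fmorph_div rmorphM rmorphD rmorph1.
Qed.
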